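(* Suppose $\nu^k\in\mathbb R^n$ are real common eigenvectors of the matrices $A_j$ corresponding to the eigenvalues $\lambda_k^j$, $j=1,\ldots,m$, $k=1,\ldots,m+1$, respectively. Then the completely solvable system $dx=A(x)\,dt$ has the autonomous first integral $$F\colon x\to\prod_{k=1}^{m+1}\bigl|\nu^kx\bigr|^{h_k}\quad\text{for all }x\in\mathscr X,\qquad\mathscr X\subset{\rm D}(F),$$ where $\mathscr X$ is a domain and $h_1,\ldots,h_{m+1}$ is a real nontrivial solution of the system $\sum_{k=1}^{m+1}\lambda_k^jh_k=0$, $j=1,\ldots,m$.
   Context: Let $x=(x_1,\ldots,x_n)\in\mathbb R^n$, $t=(t_1,\ldots,t_m)\in\mathbb R^m$. Consider the linear autonomous system of equations in total differentials $dx=A(x)\,dt$, where $A(x)=\|a_{ij}(x)\|$ is $n\times m$ with $a_{ij}(x)=\sum_{\xi=1}^na_{ij\xi}x_\xi$, $a_{ij\xi}\in\mathbb R$. Put $\mathfrak p_j(x)=\sum_{i=1}^na_{ij}(x)\partial_{x_i}$, $j=1,\ldots,m$. The system is assumed completely solvable: $[\mathfrak p_j,\mathfrak p_\zeta]=0$ on $\mathbb R^n$ for all $j,\zeta$. Let $A_j$ be the real $n\times n$ matrix whose entry in row $i$ and column $\xi$ is $a_{\xi ji}$ (so the system is $dx=\sum_jA_j^{T}x\,dt_j$); complete solvability is equivalent to $A_jA_\zeta=A_\zeta A_j$ for all $j,\zeta$. For a vector $\nu$, $\nu x=\sum_{i=1}^n\nu_ix_i$. A continuously differentiable function $F$ on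 a domain $\mathscr X\subset\mathbb R^n$ is an autonomous first integral if $\mathfrak p_jF=0$ on $\mathscr X$, $j=1,\ldots,m$. ${\rm D}(F)$ denotes the set where $F$ is defined and continuously differentiable. *)

(* Defs.v *)
From HB Require Import structures.
From mathcomp Require Import all_boot all_order all_algebra.
From mathcomp Require Import all_classical all_reals all_analysis.

Set Implicit Arguments.
Unset Strict Implicit.
Unset Printing Implicit Defensive.

Import Order.TTheory GRing.Theory Num.Theory.
Import numFieldNormedType.Exports.

Local Open Scope classical_set_scope.
Local Open Scope ring_scope.

(* The points of R^n are column vectors; every function on R^n is total, and
   the set on which a partially defined function makes sense is carried
   separately. *)

Definition is_domain (R : realType) (n : nat) (X : set 'cV[R]_n) : Prop :=
  [/\ X !=set0, open X & connected X].

Definition partial (R : realType) (n : nat) (i : 'I_n) (f : 'cV[R]_n -> R)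
    (x : 'cV[R]_n) : R :=
  'D_(delta_mx i 0) f x.

(* Continuity of the partial derivatives is not taken relatively to X; this is
   immaterial since the notion is only used on open sets. *)
Definition cont_diff_on (R : realType) (n : nat) (X : set 'cV[R]_n)
    (f : 'cV[R]_n -> R) : Prop :=
  forall (x : 'cV[R]_n) (i : 'I_n), X x ->
    derivable f x (delta_mx i 0) /\ {for x, continuous (partial i f)}.

(* D(F), for a function F which is meaningful on the set S only. *)
Definition cont_diff_dom (R : realType) (n : nat) (S : set 'cV[R]_n)
    (F : 'cV[R]_n -> R) : set 'cV[R]_n :=
  [set x | exists U : set 'cV[R]_n,
     [/\ open U, U x, U `<=` S & cont_diff_on U F]].

(* The vector field v acting as the operator \sum_i v_i d/dx_i. *)
Definition field_op (R : realType) (n : nat) (v : 'cV[R]_n -> 'cV[R]_n)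
    (f : 'cV[R]_n -> R) (x : 'cV[R]_n) : R :=
  \sum_(i < n) v x i 0 * partial i f x.

Definition lie_bracket (R : realType) (n : nat)
    (v w : 'cV[R]_n -> 'cV[R]_n) (x : 'cV[R]_n) : 'cV[R]_n :=
  \col_(i < n) (field_op v (fun y => w y i 0) x -
                field_op w (fun y => v y i 0) x).

(* In what follows a i j xi is the coefficient of x_xi in the entry a_ij(x) of
   the matrix A(x) of the system dx = A(x) dt. *)
Definition sysmx (R : realType) (n m : nat) (a : 'I_n -> 'I_m -> 'I_n -> R)
    (x : 'cV[R]_n) : 'M[R]_(n, m) :=
  \matrix_(i < n, j < m) \sum_(xi < n) a i j xi * x xi 0.

Definition sysfield (R : realType) (n m : nat) (a : 'I_n -> 'I_m -> 'I_n -> R)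
    (j : 'I_m) (x : 'cV[R]_n) : 'cV[R]_n :=
  col j (sysmx a x).

Definition completely_solvable (R : realType) (n m : nat)
    (a : 'I_n -> 'I_m -> 'I_n -> R) : Prop :=
  forall (j zeta : 'I_m) (x : 'cV[R]_n),
    lie_bracket (sysfield a j) (sysfield a zeta) x = 0.

Definition first_integral (R : realType) (n m : nat)
    (a : 'I_n -> 'I_m -> 'I_n -> R) (X : set 'cV[R]_n)
    (F : 'cV[R]_n -> R) : Prop :=
  [/\ is_domain X, cont_diff_on X F &
      forall (j : 'I_m) (x : 'cV[R]_n), X x -> field_op (sysfield a j) F x = 0].

(* The indices are exchanged: sysfield a j x = (coefmx a j)^T *m x. *)
Definition coefmx (R : realType) (n m : nat) (a : 'I_n -> 'I_m -> 'I_n -> R)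
    (j : 'I_m) : 'M[R]_n :=
  \matrix_(i < n, xi < n) a xi j i.

Definition is_common_eigenvector (R : realType) (n m : nat)
    (M : 'I_m -> 'M[R]_n) (lambda : 'I_m -> R) (v : 'cV[R]_n) : Prop :=
  v != 0 /\ forall j : 'I_m, M j *m v = lambda j *: v.

Definition linform (R : realType) (n : nat) (v x : 'cV[R]_n) : R :=
  \sum_(i < n) v i 0 * x i 0.

Definition powprod (R : realType) (n p : nat) (nu : 'I_p -> 'cV[R]_n)
    (h : 'I_p -> R) (x : 'cV[R]_n) : R :=
  \prod_(k < p) `|linform (nu k) x| `^ h k.

(* powR gives 0 the value 0 at a negative exponent; the points where this
   happens are excluded.  The convention 0 `^ 0 = 1 of powR is kept. *)
Definition powprod_dom (R : realType) (n p : nat) (nu : 'I_p -> 'cV[R]_n)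
    (h : 'I_p -> R) : set 'cV[R]_n :=
  [set x | forall k : 'I_p, h k < 0 -> linform (nu k) x != 0].

(* Main.v *)
Require Import Defs.
From HB Require Import structures.
From mathcomp Require Import all_boot all_order all_algebra.
From mathcomp Require Import all_classical all_reals all_analysis.

Set Implicit Arguments.
Unset Strict Implicit.
Unset Printing Implicit Defensive.

Import Order.TTheory GRing.Theory Num.Theory.
Import numFieldNormedType.Exports.

Local Open Scope classical_set_scope.
Local Open Scope ring_scope.

(** Write l_k for the linear form with coefficient vector nu_k, and p_j for the
    operator attached to the j-th vector field.  Since this field is the linear
    map with matrix A_j^T, an eigenvector nu_k of A_j gives p_j l_k =
    lambda_k^j l_k: the l_k are linear partial integrals with constant
    cofactors ([linform_sysfield]).  Where no l_k vanishes, F is a product of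
    smooth functions |l_k|^h_k whose logarithmic derivatives add up
    ([is_derive_normr_powR], [is_derive_prod_log], [field_op_powprod]), so that
    p_j F = F * \sum_k h_k (p_j l_k) / l_k = F * \sum_k h_k lambda_k^j = 0
    ([field_op_powprod_eq0]).

    The set X may still meet some of the hyperplanes l_k = 0, for instance when
    h_k > 1, and there the logarithmic derivative makes no sense.  But F is
    continuously differentiable on X, so p_j F is continuous at every point of
    X, and the complement of finitely many hyperplanes is dense
    ([dense_linforms_neq0]).  The value of p_j F on the hyperplanes is thus a
    limit of zeros ([dense_eq0]). *)

Lemma linformE (R : realType) (n : nat) (v x : 'cV[R]_n) :
  linform v x = (v^T *m x) 0 0.
Proof. by rewrite mxE; apply: eq_bigr => i _; rewrite mxE. Qed.

Lemma linformDZ (R : realType) (n : nat) (v x y : 'cV[R]_n) (s : R) :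
  linform v (s *: y + x) = s * linform v y + linform v x.
Proof. by rewrite !linformE mulmxDr -scalemxAr !mxE. Qed.

Lemma linform_delta (R : realType) (n : nat) (v : 'cV[R]_n) (i : 'I_n) :
  linform v (delta_mx i 0) = v i 0.
Proof. by rewrite linformE -colE !mxE. Qed.

Lemma linform_self_neq0 (R : realType) (n : nat) (v : 'cV[R]_n) :
  v != 0 -> linform v v != 0.
Proof.
apply: contraNneq => /eqP.
rewrite psumr_eq0 => [|i _]; last by rewrite -expr2 sqr_ge0.
move=> /allP v0; apply/eqP/colP => i; rewrite mxE.
by have := v0 i (mem_index_enum i); rewrite mulf_eq0 orbb => /eqP.
Qed.

Lemma linform_continuous (R : realType) (n : nat) (v : 'cV[R]_n) :
  continuous (linform v).
Proof.
apply: continuous_big => [|i _ x]; first exact: add_continuous.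
exact: (continuous_comp (@coord_continuous _ _ _ i 0 x)
  (@mulrl_continuous _ (v i 0) _)).
Qed.

(** Duality between the system and the matrices A_j: the field is the transpose
    of A_j acting on points, so its derivative action on linear forms is A_j
    itself.  This is what turns eigenvectors into linear partial integrals. *)
Lemma linform_sysfield (R : realType) (n m : nat)
    (a : 'I_n -> 'I_m -> 'I_n -> R) (j : 'I_m) (v x : 'cV[R]_n) :
  linform v (sysfield a j x) = linform (coefmx a j *m v) x.
Proof.
rewrite !linformE trmx_mul -mulmxA; congr ((_ *m _) 0 0).
by apply/colP => i; rewrite !mxE; apply: eq_bigr => xi _; rewrite !mxE.
Qed.

Lemma sysfield_continuous (R : realType) (n m : nat)
    (a : 'I_n -> 'I_m -> 'I_n -> R) (j : 'I_m) (i : 'I_n) :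
  continuous (fun x => sysfield a j x i 0).
Proof.
rewrite [X in continuous X](_ : _ = linform (\col_xi a i j xi)).
  exact: linform_continuous.
by apply/funext => x; rewrite !mxE; apply: eq_bigr => xi _; rewrite mxE.
Qed.

Lemma open_linform_neq0 (R : realType) (n : nat) (v : 'cV[R]_n) :
  open [set x | linform v x != 0].
Proof.
apply: (@open_comp _ _ (linform v) [set t | t != 0]); last exact: open_neq.
by move=> x _; exact: linform_continuous.
Qed.

(** A point of the hyperplane leaves it when moved along the normal v, since
    the form takes the value |v|^2 > 0 at v. *)
Lemma dense_linform_neq0 (R : realType) (n : nat) (v : 'cV[R]_n) :
  v != 0 -> dense [set x | linform v x != 0].
Proof.
move=> v0 U [x Ux] oU.
have [lx0|lx] := eqVneq (linform v x) 0; last by exists x.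
have : \forall s \near (0 : R)^', U (s *: v + x).
  apply: cvg_within; apply: (_ : (fun s : R => s *: v + x) @ 0 --> x).
    rewrite -[X in _ --> X]add0r -[X in X + _](scale0r v).
    by apply: cvgD; [apply: cvgZr_tmp; exact: cvg_id | exact: cvg_cst].
  exact: open_nbhs_nbhs.
move=> US.
have [s [Us s0]] : exists s : R, U (s *: v + x) /\ s != 0.
  have : \forall s \near (0 : R)^', U (s *: v + x) /\ s != 0.
    by near=> s; split; near: s => //; exact: nbhs_dnbhs_neq.
  exact: filter_ex.
exists (s *: v + x); split => //=.
by rewrite linformDZ lx0 addr0 mulf_neq0// linform_self_neq0.
Unshelve. all: by end_near. Qed.

(** Openness is carried through the induction because the intersection of two
    dense sets is dense only when one of them is open. *)
Lemma dense_linforms_neq0 (R : realType) (n p : nat) (nu : 'I_p -> 'cV[R]_n) :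
  (forall k, nu k != 0) -> dense [set x | forall k, linform (nu k) x != 0].
Proof.
move=> nu0.
suff : forall s : seq 'I_p,
    let S := [set x | forall k, k \in s -> linform (nu k) x != 0] in
    open S /\ dense S.
  move=> /(_ (enum 'I_p)) [_ dS] U U0 oU.
  have [x [Ux Sx]] := dS U U0 oU.
  by exists x; split => //= k; apply: Sx; rewrite mem_enum.
elim=> [|k s [oS dS]] /=.
  rewrite (_ : [set _ | _] = setT); last by apply/seteqP; split.
  split; [exact: openT | by move=> U [x Ux] _; exists x].
rewrite (_ : [set _ | _] = [set x | linform (nu k) x != 0] `&`
    [set x | forall k, k \in s -> linform (nu k) x != 0]).
  split; first by apply: openI => //; exact: open_linform_neq0.
  by apply: denseI; [exact: open_linform_neq0 | exact: dense_linform_neq0 |].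
apply/seteqP; split=> x /=.
  move=> H; split=> [|l ls]; first by apply: H; rewrite mem_head.
  by apply: H; rewrite in_cons ls orbT.
by move=> [lk H] l; rewrite in_cons => /predU1P[->//|]; exact: H.
Qed.

(** The derivative is written as the function times its logarithmic derivative
    h / t, the form that [is_derive_prod_log] sums; it is the same on both
    sides of 0. *)
Lemma is_derive_normr_powR (R : realType) (h t : R) : t != 0 ->
  is_derive t 1 (fun y : R => `|y| `^ h) (`|t| `^ h * (h / t)).
Proof.
move=> t0; have st0 : 0 < Num.sg t * t by rewrite -normrEsg normr_gt0.
(* Near t the absolute value of y is sg(t) y, so |y|^h is smooth there. *)
pose g y := expR (h * ln (Num.sg t * y)).
have gE : \forall y \near t, g y = `|y| `^ h.
  have : \forall y \near t, 0 < Num.sg t * y.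
    exact: (@mulrl_continuous _ (Num.sg t) t _ (lt_nbhsr st0)).
  apply: filterS => y sty; rewrite /g /powR.
  have y0 : y != 0 by apply: contraTneq sty => ->; rewrite mulr0 ltxx.
  rewrite normr_eq0 (negbTE y0) -(gtr0_norm sty) normrM normr_sg t0.
  by rewrite mul1r.
apply: (near_eq_is_derive gE).
have dl : is_derive t 1 (fun y : R => Num.sg t * y) (Num.sg t).
  have := @is_deriveZ _ _ _ (@id R) (Num.sg t) t 1 1 (is_derive_id _ _).
  by rewrite /GRing.scale /= mulr1.
have dln := is_derive1_comp (is_derive1_ln st0) dl.
have dhln := @is_deriveZ _ _ _ _ h t 1 _ dln.
have dg := is_derive1_comp (is_derive_expR _) dhln.
apply: (is_derive_eq dg).
rewrite /= -[expR _]/(g t) (nbhs_singleton gE); congr (_ * _).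
rewrite /GRing.scale/= invfM mulrAC mulVf ?mul1r//.
by rewrite sgr_eq0.
Qed.

(** Leibniz rule in logarithmic form.  Stating the hypothesis multiplicatively,
    with c k the logarithmic derivative of f k, avoids dividing by f k x. *)
Lemma is_derive_prod_log (R : realType) (V : normedModType R) (p : nat)
    (f : 'I_p -> V -> R) (c : 'I_p -> R) (x v : V) :
  (forall k, is_derive x v (f k) (f k x * c k)) ->
  is_derive x v (fun y => \prod_(k < p) f k y)
                (\prod_(k < p) f k x * \sum_(k < p) c k).
Proof.
elim: p f c => [|p IH] f c df.
  rewrite !big_ord0 mulr0 (_ : (fun _ => _) = cst 1).
    exact: is_derive_cst.
  by apply/funext => y; rewrite big_ord0.
have dF := IH (fun k => f (lift ord0 k)) (fun k => c (lift ord0 k))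
  (fun k => df _).
have d := is_deriveM (df ord0) dF.
rewrite (_ : (fun _ => _) =
    f ord0 * (fun y => \prod_(k < p) f (lift ord0 k) y)).
  apply: (is_derive_eq d).
  by rewrite !big_ord_recl /GRing.scale/= addrC mulrCA mulrDr !mulrA.
by apply/funext => y; rewrite big_ord_recl.
Qed.

(** Reduces directional derivatives to functions of one real variable, where
    the chain rule applies to [is_derive_normr_powR]. *)
Lemma derive_line (R : realType) (V : normedModType R) (f : V -> R) (x v : V) :
  'D_v f x = 'D_1 (fun t : R => f (t *: v + x)) 0.
Proof.
rewrite /derive.
suff -> : (fun t : R => t^-1 *: ((f \o shift x) (t *: v) - f x)) =
          (fun t : R => t^-1 *: (((fun u : R => f (u *: v + x)) \o shift 0)
             (t *: 1) - f (0 *: v + x))) by [].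
apply/funext => t /=.
by rewrite /shift/= scale0r add0r addr0 [t *: 1]mulr1.
Qed.

Lemma derive_powprod (R : realType) (n p : nat) (nu : 'I_p -> 'cV[R]_n)
    (h : 'I_p -> R) (x v : 'cV[R]_n) :
  (forall k, linform (nu k) x != 0) ->
  'D_v (powprod nu h) x =
  powprod nu h x * \sum_(k < p) h k * (linform (nu k) v / linform (nu k) x).
Proof.
move=> nux; rewrite derive_line.
pose l k (t : R) := linform (nu k) (t *: v + x).
have l0 k : l k 0 = linform (nu k) x by rewrite /l scale0r add0r.
have dl k : is_derive (0 : R) 1 (l k) (linform (nu k) v).
  rewrite (_ : l k = linform (nu k) v *: id + cst (linform (nu k) x)).
    have dz := @is_deriveZ _ _ _ (@id R) (linform (nu k) v) 0 1 1
      (is_derive_id _ _).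
    have := is_deriveD dz (is_derive_cst (linform (nu k) x) (0 : R) 1).
    by move=> d; apply: (is_derive_eq d); rewrite addr0 /GRing.scale/= mulr1.
  apply/funext => t; rewrite /l linformDZ.
  by congr (_ + _); rewrite mulrC.
have df k : is_derive (0 : R) 1 (fun t => `|l k t| `^ h k)
    (`|l k 0| `^ h k * (h k * (linform (nu k) v / linform (nu k) x))).
  have lk0 : l k 0 != 0 by rewrite l0.
  have d := is_derive1_comp (is_derive_normr_powR (h k) lk0) (dl k).
  apply: (is_derive_eq d); rewrite l0 -!mulrA.
  by congr (_ * (_ * _)); rewrite mulrC.
have [_ dprod] := is_derive_prod_log df.
rewrite [LHS]dprod; congr (_ * _).
by apply: eq_bigr => k _; rewrite l0.
Qed.

Lemma field_op_powprod (R : realType) (n p : nat) (nu : 'I_p -> 'cV[R]_n)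
    (h : 'I_p -> R) (v : 'cV[R]_n -> 'cV[R]_n) (x : 'cV[R]_n) :
  (forall k, linform (nu k) x != 0) ->
  field_op v (powprod nu h) x =
  powprod nu h x * \sum_(k < p) h k * (linform (nu k) (v x) / linform (nu k) x).
Proof.
move=> nux; rewrite /field_op /partial.
under eq_bigr => i _ do rewrite derive_powprod// mulrCA.
rewrite -mulr_sumr; congr (_ * _).
under eq_bigr do rewrite mulr_sumr.
rewrite exchange_big; apply: eq_bigr => k _ /=.
rewrite [linform _ (v x)]/linform mulr_suml mulr_sumr; apply: eq_bigr => i _.
by rewrite linform_delta mulrCA; congr (_ * _); rewrite mulrCA mulrA.
Qed.

Lemma field_op_powprod_eq0 (R : realType) (n m p : nat)
    (a : 'I_n -> 'I_m -> 'I_n -> R) (nu : 'I_p -> 'cV[R]_n)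
    (lambda : 'I_p -> 'I_m -> R) (h : 'I_p -> R) (j : 'I_m) (x : 'cV[R]_n) :
  (forall k, coefmx a j *m nu k = lambda k j *: nu k) ->
  \sum_(k < p) lambda k j * h k = 0 ->
  (forall k, linform (nu k) x != 0) ->
  field_op (sysfield a j) (powprod nu h) x = 0.
Proof.
move=> nuE hE nux; rewrite field_op_powprod//.
suff : \sum_(k < p)
         h k * (linform (nu k) (sysfield a j x) / linform (nu k) x) =
       \sum_(k < p) lambda k j * h k by move=> ->; rewrite hE mulr0.
apply: eq_bigr => k _; rewrite linform_sysfield nuE.
have -> : linform (lambda k j *: nu k) x = lambda k j * linform (nu k) x.
  by rewrite !linformE linearZ/= -scalemxAl mxE.
by rewrite mulfK// mulrC.
Qed.

(** Carries the identity p_j F = 0 over to the hyperplanes; continuity is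
    required at the single point x only. *)
Lemma dense_eq0 (R : realType) (T : topologicalType) (S : set T) (f : T -> R)
    (x : T) :
  dense S -> (forall y, S y -> f y = 0) -> {for x, continuous f} -> f x = 0.
Proof.
move=> dS fS cf; apply/eqP/negPn/negP => fx0.
have : nbhs x [set y | f y != 0].
  have ofx : open_nbhs (f x) [set t | t != 0] by split=> //; exact: open_neq.
  exact: (cf _ (open_nbhs_nbhs ofx)).
rewrite nbhsE => -[U [oU Ux] Uf].
have [y [Uy Sy]] := dS U (ex_intro _ x Ux) oU.
by have := Uf y Uy; rewrite /= fS// eqxx.
Qed.

Lemma sum_mul_continuous (R : realType) (T : topologicalType) (n : nat)
    (f g : 'I_n -> T -> R) (x : T) :
  (forall i, {for x, continuous (f i)}) ->
  (forall i, {for x, continuous (g i)}) ->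
  {for x, continuous (fun y => \sum_(i < n) f i y * g i y)}.
Proof.
move=> cf cg; apply: cvg_big => [|i _]; first exact: add_continuous.
exact: (continuousM (cf i) (cg i)).
Qed.

Theorem theorem2p1 (R : realType) (n m : nat)
  (a : 'I_n -> 'I_m -> 'I_n -> R)
  (Hsolv : completely_solvable a)
  (nu : 'I_m.+1 -> 'cV[R]_n) (lambda : 'I_m.+1 -> 'I_m -> R)
  (Hnu : forall k : 'I_m.+1, is_common_eigenvector (coefmx a) (lambda k) (nu k))
  (h : 'I_m.+1 -> R)
  (Hnontriv : exists k : 'I_m.+1, h k != 0)
  (Hh : forall j : 'I_m, \sum_(k < m.+1) lambda k j * h k = 0)
  (X : set 'cV[R]_n)
  (HX : is_domain X)
  (HXD : X `<=` cont_diff_dom (powprod_dom nu h) (powprod nu h)) :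
  first_integral a X (powprod nu h).
Proof.
have cX : cont_diff_on X (powprod nu h).
  by move=> x i /HXD [U [_ Ux _ cU]]; exact: cU.
split=> // j x Xx.
apply: (dense_eq0 (dense_linforms_neq0 (fun k => (Hnu k).1))) => [y nuy|].
  by apply: (field_op_powprod_eq0 (lambda := lambda)) => // k;
    exact: (Hnu k).2.
apply: (sum_mul_continuous (f := fun i y => sysfield a j y i 0)) => i.
  exact: sysfield_continuous.
exact: (cX x i Xx).2.
Qed.
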